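(* For any network with connectivity graph $G=(V,E)$ of $n$ nodes, set of source nodes $S\subseteq V$, diameter $D$, affectance matrix $A$, and affectance degradation distance $\alpha$, there exists a Multiple-Message Broadcast protocol such that the competitive throughput converges to $$\frac{1}{O(\alpha K\log n)}$$ (that is, the limiting competitive throughput is $\Omega(1/(\alpha K\log n))$, with an absolute implied constant), where $K=\max_{s\in S}K(T_{\min}(s),s)$ and, for each $s\in S$, $T_{\min}(s)$ is a BFS tree rooted at $s$ minimizing $M(T,s)\left(\frac{M(T,s)}{\log n}+K(T,s)\right)$ over all BFS trees $T$ rooted at $s$.
   Context: Here $\log=\log_2$. Network model. A network has $n$ nodes and a connected, possibly multihop, undirected connectivity graph $G=(V,E)$; a link is an ordered pair $(u,v)\in E$, meaning that a transmission from $u$ may be received by $v$. Time is divided into slots $1,2,\dots$. In each slot a node either transmits or listens, but not both; one slot suffices to transmit one packet to a neighbor. Interference is given by a nonnegative real matrix $A$ of size $|V|\times|E|$, where $A(u,(v,w))$ quantifies the interference that a transmitting node $u$ introduces on link $(v,w)$. For $V'\subseteq V$, $E'\subseteq E$ put $$a_{V'}((v,w))=\sum_{u\in V',\,u\neq v}A(u,(v,w)),\qquad a_{V'}(E')=\sum_{(v,w)\in E'}a_{V'}((v,w)).$$ For $(u,v)\in E$, a transmission from $u$ is received at $v$ in slot $t$ if and only if $u$ transmits and $v$ listens in slot $t$ and $a_{\mathcal T(t)}((u,v))<1$, where $\mathcal T(t)$ is the set of nodes transmitting in slot $t$. Listening nodes cannot distinguish a collision from background noise. The affectance degradation distance is the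 number of hops $\alpha$ such that the affectance of every node at distance at least $\alpha$ hops from a link on that link is zero. Multiple-Message Broadcast. Starting at slot $1$, packets are injected by an adversary at the beginning of slots into source nodes (the nodes of $S$), online. A packet is delivered once all nodes of the network have received it. Injections are restricted to be feasible: there exists an optimal algorithm OPT for which the latency (time from injection to delivery) of each packet is bounded; since a node receives at most one packet per slot, this limits the injection to at most one packet per time slot in the whole network. A Multiple-Message Broadcast protocol is a deterministic distributed online algorithm for disseminating the injected packets; it may depend on the network (topology and affectance are known to the nodes after preprocessing). Competitive throughput. For an algorithm $X$, let $d_X(t)$ be the number of packets delivered to all nodes by $X$ until slot $t$. The competitive throughput of a protocol ALG is $\lim_{t\to\infty} d_{ALG}(t)/d_{OPT}(t)$, under any feasible adversarial injection. Affectance characteristics. For a BFS tree $T$ of $G$ rooted at $s$, let $V_d(T)$ be the set of nodes at distance $d$ from $s$, and for $V'\subseteq V_d(T)$ let $L(V')$ be the set of tree links from $V'$ to nodes at distance $d+1$ from $s$. The maximum average tree-layer affectance is $$K(T,s)=\max_d\ \max_{V'\subseteq V_d(T)}\frac{1}{|L(V')|}a_{V'}(L(V'))$$ (over $V'$ with $L(V')\neq\emptyset$). The maximum path affectance is $$M(T,s)=\max_{p\in P(T)}\sum_{(u,v)\in p}a_{V_{d(u)}(T)}((u,v)),$$ where $d(u)$ is the distance from $u$ to $s$ and $P(T)$ is the set of root-to-leaf paths of $T$, each viewed as a set of links directed away from $s$.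
   Formalization: The bound is 1/(C·max(1, αK log n)) instead of 1/(C·αK log n), which is undefined for K=0 or n=1 and exceeds the attainable ratio 1 when αK log n is tiny; at least one packet is assumed injected, so that the ratio is defined. *)

(* Defs.v *)
(* MathComp world (with MathComp-Analysis for the reals and limits). *)
From HB Require Import structures.
From mathcomp Require Import all_boot all_order all_algebra.
From mathcomp Require Import all_classical all_reals all_analysis.

Set Implicit Arguments.
Unset Strict Implicit.
Unset Printing Implicit Defensive.

Import Order.TTheory GRing.Theory Num.Theory.
Import numFieldNormedType.Exports.

Local Open Scope ring_scope.

Definition log2 (R : realType) (x : R) : R := ln x / ln 2.

(** * Hop distances in a graph given by an edge relation *)

(* Least length of a walk from [u] to [v]; the search is cut at [#|V|], which
   is harmless in a connected graph. *)
Definition hops (V : finType) (e : rel V) (u v : V) : nat :=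
  find (fun k => [exists p : k.-tuple V, path e u p && (last u p == v)])
       (iota 0 #|V|).

Definition diameter (V : finType) (e : rel V) : nat :=
  (\max_(u : V) \max_(v : V) hops e u v)%N.

Definition hops_to_link (V : finType) (e : rel V) (u : V) (l : V * V) : nat :=
  minn (hops e u l.1) (hops e u l.2).

(** * Affectance *)

(* The matrix is indexed by all ordered pairs, but only its entries on links
   (pairs related by [e]) are ever constrained or used. *)
Section Affectance.
Variables (R : realType) (V : finType).
Implicit Types (e : rel V) (A : V -> V * V -> R).

Definition aff A (X : {set V}) (l : V * V) : R :=
  \sum_(u in X | u != l.1) A u l.

Definition aff_links A (X : {set V}) (E : {set V * V}) : R :=
  \sum_(l in E) aff A X l.

Definition degradation_distance e A (alpha : nat) : Prop :=
  forall u v w, e v w -> (alpha <= hops_to_link e u (v, w))%N ->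
  A u (v, w) = 0.

(** * BFS trees and their affectance characteristics *)

(* A rooted tree is encoded by its parent function, the root being its own
   parent. *)
Definition bfs_tree e (s : V) (T : {ffun V -> V}) : Prop :=
  T s = s /\
  forall v, v != s -> e (T v) v /\ hops e s v = (hops e s (T v)).+1.

Definition layer e (s : V) (d : nat) : {set V} := [set v | hops e s v == d].

Definition tree_links (s : V) (T : {ffun V -> V}) (X : {set V}) :
  {set V * V} := [set (T w, w) | w in [set w | (w != s) && (T w \in X)]].

Definition tree_leaf (s : V) (T : {ffun V -> V}) (v : V) : bool :=
  [forall w, (w != s) ==> (T w != v)].

Definition root_path (s : V) (T : {ffun V -> V}) (v : V) : {set V * V} :=
  [set (T w, w) | w in [set w | (w != s) && fconnect T v w]].

Definition avg_layer_aff e A (s : V) (T : {ffun V -> V}) : R :=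
  \big[Num.max/0]_(d < #|V|)
    \big[Num.max/0]_(X : {set V} |
          (X \subset layer e s d) && (0 < #|tree_links s T X|)%N)
      (aff_links A X (tree_links s T X) / #|tree_links s T X|%:R).

Definition path_aff e A (s : V) (T : {ffun V -> V}) : R :=
  \big[Num.max/0]_(v | tree_leaf s T v)
    \sum_(l in root_path s T v) aff A (layer e s (hops e s l.1)) l.

Definition tree_cost e A (s : V) (T : {ffun V -> V}) : R :=
  path_aff e A s T *
  (path_aff e A s T / log2 (#|V|%:R) + avg_layer_aff e A s T).

Definition min_bfs_tree e A (s : V) (T : {ffun V -> V}) : Prop :=
  bfs_tree e s T /\
  forall T', bfs_tree e s T' -> tree_cost e A s T <= tree_cost e A s T'.

(* [X] is the set of nodes transmitting in the slot. *)
Definition receives e A (X : {set V}) (u v : V) : bool :=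
  [&& e u v, u \in X, v \notin X & aff A X (u, v) < 1].

End Affectance.

(** * Injections and executions *)

(* Packets are opaque: the adversary labels them by arbitrary distinct
   numbers. *)
Definition packet := nat.

(* The packet, with its source, injected at the beginning of each slot. There
   is at most one per slot in the whole network. Slots are numbered from 1;
   index 0 is never looked at, here and in executions. *)
Definition injection (V : finType) := nat -> option (V * packet).

(* What each node does in each slot: [None] = listen, [Some None] = transmit
   control information only, [Some (Some p)] = transmit packet [p]. *)
Definition execution (V : finType) := nat -> V -> option (option packet).

Section Executions.
Variables (R : realType) (V : finType) (e : rel V) (A : V -> V * V -> R).
Implicit Types (inj : injection V) (x : execution V).

Definition transmitters (T : Type) (act : V -> option T) : {set V} :=
  [set u | isSome (act u)].

(* Node [v] has packet [p] at the end of slot [t]. *)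
Fixpoint has_packet inj x (t : nat) (v : V) (p : packet) : bool :=
  if t isn't t'.+1 then false else
  [|| has_packet inj x t' v p,
      inj t == Some (v, p)
    | [exists u, receives e A (transmitters (x t)) u v &&
                 (x t u == Some (Some p))]].

(* Store and forward: only packets in possession are transmitted. *)
Definition valid_execution inj x : Prop :=
  forall t u p, x t.+1 u = Some (Some p) ->
    has_packet inj x t u p \/ inj t.+1 = Some (u, p).

Definition delivered inj x (t : nat) (p : packet) : bool :=
  [forall v, has_packet inj x t v p].

Definition num_delivered inj x (t : nat) : nat :=
  count (fun i => if inj i is Some (_, p) then delivered inj x t p else false)
        (iota 1 t).

Definition bounded_latency inj x : Prop :=
  exists B : nat, forall i v p,
    (0 < i)%N -> inj i = Some (v, p) -> delivered inj x (i + B) p.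

Definition legal_injection (S : {set V}) inj : Prop :=
  [/\ forall i v p, (0 < i)%N -> inj i = Some (v, p) -> v \in S
    & forall i j u v p, (0 < i)%N -> (0 < j)%N ->
        inj i = Some (u, p) -> inj j = Some (v, p) -> i = j].

(* An (offline, centralized) algorithm witnessing that [inj] is feasible. *)
Definition opt_execution inj x : Prop :=
  valid_execution inj x /\ bounded_latency inj x.

End Executions.

(** * Deterministic distributed online protocols *)

(* Each node runs a state machine. Besides at most one packet, a transmission
   carries control information from a finite alphabet fixed by the protocol.
   The decision for a slot depends on the local state and on the packet, if
   any, injected locally at the beginning of the slot. The feedback maps each
   node [u] to the message received from [u], if any; a collision is
   indistinguishable from silence. *)
Record protocol (V : finType) := Protocol {
  pctrl : finType;
  pstate : Type;
  pinit : V -> pstate;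
  pact : V -> pstate -> option packet -> option (option packet * pctrl);
  pnext : V -> pstate -> option packet ->
          {ffun V -> option (option packet * pctrl)} -> pstate
}.

Section Runs.
Variables (R : realType) (V : finType) (e : rel V) (A : V -> V * V -> R).
Variables (P : protocol V) (inj : injection V).

Definition local_injection (t : nat) (v : V) : option packet :=
  if inj t is Some (u, p) then (if u == v then Some p else None) else None.

Definition actions_from (st : V -> pstate P) (t : nat) (v : V) :
    option (option packet * pctrl P) :=
  pact v (st v) (local_injection t v).

(* State of each node at the end of slot [t]. *)
Fixpoint run_state (t : nat) : V -> pstate P :=
  if t isn't t'.+1 then @pinit V P else
  let act := actions_from (run_state t') t in
  fun v => pnext v (run_state t' v) (local_injection t v)
    [ffun u => if receives e A (transmitters act) u v then act u else None].

Definition run : execution V :=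
  fun t v => omap fst (actions_from (run_state t.-1) t v).

End Runs.

Definition broadcast_protocol (R : realType) (V : finType) (e : rel V)
    (A : V -> V * V -> R) (P : protocol V) : Prop :=
  forall inj, valid_execution e A inj (run e A P inj).

Definition throughput_ratio (R : realType) (V : finType) (e : rel V)
    (A : V -> V * V -> R) (inj : injection V) (alg opt : execution V)
    (t : nat) : R :=
  (num_delivered e A inj alg t)%:R / (num_delivered e A inj opt t)%:R.

(* Main.v *)
(* The constant-factor bound holds with no reference to affectance, because the
   protocol is compared with OPT. It forwards only every 12th packet of each
   source and discards the others for good, which makes the ratio converge; it
   remains to deliver the forwarded packets with bounded latency. Time is cut
   into windows, half of each being spent on flooding round robin the times of
   the injections of the previous window. All nodes thus agree, two windows
   late, on the injection pattern, and run the same optimal schedule for each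
   successive batch of forwarded packets. The optimal time of a batch is
   subadditive, hence linear up to a factor 2 and lower order terms: delivering
   a twelfth of the packets takes at most a quarter of the time (plus a
   constant). OPT delivers all packets of a phase in the length of that phase
   plus a constant, so the length of the phases contracts to a bound. *)

Require Import Defs.
From HB Require Import structures.
From mathcomp Require Import all_boot all_order all_algebra.
From mathcomp Require Import all_classical all_reals all_analysis.
From mathcomp Require Import zify ring lra.
Set Implicit Arguments.
Unset Strict Implicit.
Unset Printing Implicit Defensive.

Import Order.TTheory GRing.Theory Num.Theory.
Import numFieldNormedType.Exports.

Local Open Scope nat_scope.

(** * Batch delivery *)

Section Batches.
Context {R : realType} {V : finType} (e : rel V) (A : V -> V * V -> R).
Hypothesis e_irr : irreflexive e.
Hypothesis e_conn : forall u v, connect e u v.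

(** The affectance sum leaves out the sender itself, hence is empty. *)
Lemma receives_alone u v : e u v -> receives e A [set u] u v.
Proof.
move=> euv; rewrite /receives euv !inE eqxx /=.
have -> : v != u by apply: contraTneq euv => ->; rewrite e_irr.
rewrite /aff big1 ?ltr01 // => w /andP[]; rewrite inE => /eqP ->.
by rewrite eqxx.
Qed.

Definition round_robin (t : nat) (v : V) : bool := enum_rank v == t %% #|V| :> nat.

Lemma round_robin_transmitters (T : Type) (act : V -> option T) t u :
  round_robin t u ->
  (forall v, isSome (act v) = round_robin t v) -> transmitters act = [set u].
Proof.
move=> /eqP rt Ha; apply/setP => v; rewrite !inE Ha /round_robin -rt.
by apply/eqP/eqP => [/val_inj/enum_rank_inj | ->].
Qed.

(* Along a simple path, each sweep of [#|V|] slots gains one hop. *)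
Lemma round_robin_flood (know : nat -> V -> bool) w :
  (forall t v, know t v -> know t.+1 v) ->
  (forall t u v, t < #|V| * #|V| -> round_robin t u -> e u v -> know t u -> know t.+1 v) ->
  know 0 w -> forall t v, #|V| * #|V| <= t -> know t v.
Proof.
move=> Hm Hs H0 t v Ht.
have mono a b x : a <= b -> know a x -> know b x.
  by move=> /subnK <-; elim: (b - a) => // d IH /IH; rewrite addSn; apply: Hm.
have /connectP[p0 /shortenP[p Hp Hu _] Hl] := e_conn w v.
have szp : size (w :: p) <= #|V| by rewrite -(card_uniqP Hu) max_card.
suff : forall q x j, path e x q -> j + size q < #|V| -> know (j * #|V|) x ->
    know ((j + size q) * #|V|) (last x q).
  move=> /(_ p w 0 Hp szp H0); rewrite -Hl; apply: mono.
  by apply: leq_trans Ht; rewrite leq_mul2r (ltnW szp) orbT.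
elim=> [|y q IH] x j /=; first by rewrite addn0.
rewrite addnS -addSn => /andP[exy Hq] Hj Hx.
apply: (IH y j.+1) => //.
have rx := ltn_ord (enum_rank x).
apply: (@mono (j * #|V| + enum_rank x).+1); first by rewrite mulSn addnC ltn_add2r.
apply: (Hs _ x) => //; last by apply: mono Hx; apply: leq_addr.
  apply: (@leq_trans (j.+1 * #|V|)); first by rewrite mulSn addnC ltn_add2r.
  by rewrite leq_mul2r (leq_trans _ (ltnW Hj)) ?orbT // leq_addr.
by rewrite /round_robin modnMDl modn_small.
Qed.

(* A batch names its packets [(s, k)], the [k]-th packet of source [s]. A
   transmission of a packet that the sender does not hold counts as noise, so
   that every [x] is a schedule. *)
Definition batch_schedule := nat -> V -> option (option (V * nat)).

Fixpoint knows (x : batch_schedule) (t : nat) (v : V) (p : V * nat) : bool :=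
  if t isn't t'.+1 then p.1 == v else
  knows x t' v p ||
  [exists u, [&& receives e A (transmitters (x t')) u v,
                 x t' u == Some (Some p) & knows x t' u p]].

Definition deliverable (c : V -> nat) (W : nat) : Prop :=
  exists x, forall v s k, k < c s -> knows x W v (s, k).

Lemma knows_mono x t t' v p : t <= t' -> knows x t v p -> knows x t' v p.
Proof.
by move=> /subnK <-; elim: (t' - t) => // d IH /IH Hk; rewrite addSn /= Hk.
Qed.

Lemma deliverable_le c c' W W' :
  (forall s, c' s <= c s) -> W <= W' -> deliverable c W -> deliverable c' W'.
Proof.
move=> Hc HW [x Hx]; exists x => v s k Hk.
by apply: (knows_mono HW); apply: Hx; apply: leq_trans Hk (Hc s).
Qed.

Lemma deliverable0 W : deliverable (fun=> 0) W.
Proof. by exists (fun _ _ => None). Qed.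

(** When [y] replays [x] from slot [d0] on with renamed packets, the transmitters coincide, hence
    the receptions; earlier slots can only help. *)
Lemma knows_simulation (f : V -> nat -> nat) x y d d0 v s k :
  (forall t u, t < d -> y (d0 + t) u = omap (omap (fun p => (p.1, f p.1 p.2))) (x t u)) ->
  knows x d v (s, k) -> knows y (d0 + d) v (s, f s k).
Proof.
elim: d v => [|d IH] v Hy; first by rewrite addn0 => /eqP /= ->; apply: (@knows_mono _ 0) => /=.
have {}IH u := IH u (fun t u Ht => Hy t u (ltnW Ht)).
rewrite addnS /= => /orP[/IH -> //|/existsP[u /and3P[Hr /eqP Hx /IH Hk]]].
apply/orP; right; apply/existsP; exists u; rewrite Hk Hy // Hx eqxx !andbT.
suff -> : transmitters (y (d0 + d)) = transmitters (x d) by [].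
by apply/setP => w; rewrite !inE Hy //; case: (x d w).
Qed.

(** The schedules run in succession, the second with packet numbers shifted by [c s]: this is
    subadditivity of the optimal time. *)
Lemma deliverableD c c' W W' :
  deliverable c W -> deliverable c' W' ->
  deliverable (fun s => c s + c' s) (W + W').
Proof.
move=> [x Hx] [x' Hx'].
pose y t u := if t < W then x t u
  else omap (omap (fun p : V * nat => (p.1, c p.1 + p.2))) (x' (t - W) u).
exists y => v s k Hk; case: (ltnP k (c s)) => Hkc.
  apply: (@knows_mono _ W); first exact: leq_addr.
  rewrite -[W]add0n; apply: (@knows_simulation (fun _ k => k) x).
    by move=> t u Ht; rewrite add0n /y Ht; case: (x t u) => [[[]|]|].
  exact: Hx.
rewrite -(subnKC Hkc).
apply: (@knows_simulation (fun s k => c s + k) x').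
  by move=> t u _; rewrite /y ltnNge leq_addr /= addKn.
by apply: Hx'; rewrite -subSn // leq_subLR.
Qed.

Lemma deliverableM c W q : deliverable c W -> deliverable (fun s => q * c s) (q * W).
Proof.
move=> Hc; elim: q => [|q IH]; first exact: deliverable0.
apply: deliverable_le (deliverableD Hc IH); last by rewrite mulSn.
by move=> s; rewrite mulSn.
Qed.

Lemma deliverable_one s0 : deliverable (fun s => s == s0) (#|V| * #|V|).
Proof.
exists (fun t u => if round_robin t u then Some (Some (s0, 0)) else None) => v s k.
set x := (X in knows X).
case: (s =P s0) => // -> {s}; rewrite ltnS leqn0 => /eqP ->.
apply: (@round_robin_flood (fun t v => knows x t v (s0, 0)) s0) => //=.
- by move=> t u /= ->.
- move=> t u {}v _ Hr euv Hu; apply/orP; right; apply/existsP; exists u.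
  rewrite Hu {2}/x Hr eqxx !andbT (round_robin_transmitters Hr) ?receives_alone //.
  by move=> w; rewrite /x; case: ifP.
Qed.

(** Naive delivery, one packet at a time. It handles remainders and shows that every batch is
    deliverable. *)
Lemma deliverable_cst q : deliverable (fun=> q) (q * (#|V| * (#|V| * #|V|))).
Proof.
suff H1 : deliverable (fun=> 1) (#|V| * (#|V| * #|V|)).
  by apply: deliverable_le (deliverableM q H1) => // s; rewrite muln1.
have Hr (r : seq V) : deliverable (fun s => count_mem s r) (size r * (#|V| * #|V|)).
  elim: r => [|w r IH] /=; first exact: deliverable0.
  apply: deliverable_le (deliverableD (deliverable_one w) IH); last by rewrite mulSn.
  by move=> s; rewrite eq_sym.
apply: deliverable_le (Hr (enum V)); last by rewrite -cardE.
by move=> s; rewrite -has_count has_pred1 mem_enum.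
Qed.

(* Each packet of [s] has to be transmitted by [s] in a slot of its own. *)
Lemma deliverable_lower c W s : 1 < #|V| -> deliverable c W -> c s <= W.
Proof.
move=> /card_gt1P[v1 [v2 [_ _ v12]]] [x Hx].
have [v vs] : exists v, v != s.
  by case: (v1 =P s) => [<-|/eqP ?]; [exists v2; rewrite eq_sym | exists v1].
rewrite -(size_iota 0 W) -(size_map (fun t => x t s)) -(size_iota 0 (c s)).
rewrite -(size_map (fun k => Some (Some (s, k)))).
apply: uniq_leq_size; first by rewrite map_inj_uniq ?iota_uniq // => a b [].
move=> _ /mapP[k + ->]; rewrite mem_iota add0n /= => /(Hx v s).
apply: contraTT => Hn.
(* A packet that [s] transmits in none of the slots never leaves [s]. *)
suff H : forall t w, t <= W -> knows x t w (s, k) -> w = s.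
  by apply/negP => /(H _ _ (leqnn W)) vs'; rewrite vs' eqxx in vs.
elim=> [|t IH] w Ht /=; first by move=> /eqP.
move=> /orP[/(IH _ (ltnW Ht)) //|/existsP[u /and3P[_ /eqP Hxt /(IH _ (ltnW Ht)) us]]].
case/negP: Hn; apply/mapP; exists t; first by rewrite mem_iota add0n.
by rewrite -Hxt us.
Qed.

(* Minimizing [W %/ r] comes within a factor 2 of the optimal rate, since
   [W / r >= 1]. *)
Lemma deliverable_rate b : 1 < #|V| -> exists r W0, [/\ 0 < r,
    deliverable (fun s => r * b s) W0 &
    forall q W, deliverable (fun s => q * b s) W -> q * W0 <= 2 * W * r].
Proof.
move=> V2; case: (pselect (forall s, b s = 0)) => [b0|/existsNP[s /eqP bs]].
  exists 1, 0; split=> // [|q W _]; last by rewrite muln0.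
  by apply: deliverable_le (deliverable0 0) => // s; rewrite b0.
have low q W : deliverable (fun s => q * b s) W -> q <= W.
  move=> /(deliverable_lower s V2); apply: leq_trans.
  by rewrite leq_pmulr // lt0n.
pose P f := `[< exists r W, [/\ 0 < r, deliverable (fun s => r * b s) W & W %/ r = f] >].
have exP : exists f, P f.
  exists ((1 * ((\max_s b s) * (#|V| * (#|V| * #|V|)))) %/ 1); apply/asboolP.
  exists 1; eexists; split=> //; apply: deliverableM.
  by apply: deliverable_le (deliverable_cst (\max_s b s)) => // s'; apply: leq_bigmax.
case: (ex_minnP exP) => f /asboolP[r [W0 [r0 HW0 Hf]]] Hmin.
exists r, W0; split=> // q W Hq.
case: (posnP q) => [-> //|q0].
have /Hmin fle : P (W %/ q) by apply/asboolP; exists q, W.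
have f1 : 0 < f by rewrite -Hf divn_gt0 // low.
have H1 : W0 < f.+1 * r by rewrite -ltn_divLR // Hf.
have H2 : f * q <= W by rewrite -leq_divRL.
(* As [f >= 1], [q * W0 <= q * f.+1 * r <= 2 * (f * q) * r <= 2 * W * r]. *)
nia.
Qed.

(* [c] is [q] times one of finitely many vectors [b], delivered in about
   [2 * W / 12] slots, plus a remainder below [q], delivered naively in
   [q * kap <= W / 12] slots. *)
Lemma deliverable_speedup : 1 < #|V| -> exists L0, forall a c W,
  (forall s, 12 * c s <= a s) -> deliverable a W -> deliverable c (W %/ 4 + L0).
Proof.
move=> V2; set kap := #|V| * (#|V| * #|V|).
have kap0 : 0 < kap by rewrite !muln_gt0 (ltnW V2).
have /choice[g Hg] : forall b : {ffun V -> 'I_(2 * kap)}, exists W0, exists r, [/\ 0 < r,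
    deliverable (fun s => r * b s) W0 &
    forall q W, deliverable (fun s => q * b s) W -> q * W0 <= 2 * W * r].
  by move=> b; have [r [W0 H]] := deliverable_rate (fun s => b s : nat) V2; exists W0, r.
(* The first term pays for rounding up a number of rounds, the second for batches of fewer than
   [kap] packets per source. *)
exists (\max_b g b + kap * kap) => a c W Hac Ha.
pose mc := \max_s c s.
have mcW : 12 * mc <= W.
  rewrite mulnC -leq_divRL //; apply/bigmax_leqP => s _; rewrite leq_divRL // mulnC.
  exact: leq_trans (Hac s) (deliverable_lower s V2 Ha).
have cle s : c s <= mc by exact: leq_bigmax.
case: (ltnP mc kap) => Hk.
  apply: deliverable_le (deliverable_cst kap) => [s|]; first exact: leq_trans (cle s) (ltnW Hk).
  by rewrite -/kap; lia.
pose q := mc %/ kap.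
have q0 : 0 < q by rewrite divn_gt0.
have mcq : mc < q.+1 * kap by rewrite -ltn_divLR.
(* [c s <= mc < q.+1 * kap <= 2 * q * kap]. *)
have bP s : c s %/ q < 2 * kap by rewrite ltn_divLR //; move: (cle s); nia.
pose b := [ffun s => Ordinal (bP s)].
have [r [r0 Hr Hopt]] := Hg b.
have bE s : (b s : nat) = c s %/ q by rewrite ffunE.
have Hq : (12 * q) * g b <= 2 * W * r.
  apply: Hopt; apply: deliverable_le Ha => // s; apply: leq_trans (Hac s).
  by rewrite -mulnA leq_mul2l /= bE mulnC leq_divM.
(* [(q %/ r).+1] rounds of [r * b] cover [q * b]; the remainders modulo [q] are delivered
   naively. *)
have := deliverableD (deliverableM (q %/ r).+1 Hr) (deliverable_cst q).
apply: deliverable_le => [s|].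
  rewrite {1}(divn_eq (c s) q) leq_add ?(ltnW (ltn_pmod _ _)) // bE mulnC mulnA leq_mul2r.
  by rewrite ltnW ?orbT // -ltn_divLR.
have gle : g b <= \max_b g b by exact: leq_bigmax.
have Hqk : q * kap <= mc by exact: leq_divM.
have Hqr : q %/ r * r <= q by exact: leq_divM.
have : 12 * (q %/ r) * g b <= 2 * W.
  rewrite -(leq_pmul2r r0); apply: leq_trans Hq.
  by rewrite -!mulnA leq_mul2l /= (mulnC (g b)) mulnA leq_mul2r Hqr orbT.
rewrite -/kap mulSn; lia.
Qed.

End Batches.

(** * Injections and the optimum *)

Section Events.
Context {V : finType}.
Implicit Types f g : nat -> V -> bool.

(** [f] is a pattern of arrivals or selections, either the true one or what a node has heard of it.
    Positions in the list number the packets of [s] in a batch. *)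
Definition events f (lo hi : nat) (s : V) : seq nat :=
  [seq i <- iota lo (hi - lo) | f i s].

Definition batch f (lo hi : nat) (s : V) : nat := size (events f lo hi s).

Lemma mem_events f lo hi s i : (i \in events f lo hi s) = f i s && (lo <= i < hi).
Proof.
rewrite mem_filter mem_iota; case: (leqP lo hi) => [/subnKC -> //|Hlt].
by congr (_ && _); lia.
Qed.

Lemma eq_events f g lo hi s :
  (forall i, i < hi -> f i s = g i s) -> events f lo hi s = events g lo hi s.
Proof.
by move=> Hfg; apply: eq_in_filter => i; rewrite mem_iota => Hi; apply: Hfg; lia.
Qed.

Lemma eq_batch f g lo hi :
  (forall i s, i < hi -> f i s = g i s) -> batch f lo hi = batch g lo hi.
Proof.
by move=> Hfg; apply/funext => s; rewrite /batch (@eq_events f g) // => i; apply: Hfg.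
Qed.

Lemma batch_iota f lo hi s : lo <= hi ->
  count (f^~ s) (iota 0 hi) = count (f^~ s) (iota 0 lo) + batch f lo hi s.
Proof. by move=> /subnKC {1}<-; rewrite iotaD count_cat add0n /batch size_filter. Qed.

End Events.

(** Slots are counted from 0 from here on: [i] stands for slot [i.+1] of the injection. *)
Definition arrival (V : finType) (inj : injection V) (i : nat) (v : V) : bool :=
  isSome (local_injection inj i.+1 v).

Lemma local_injectionP (V : finType) (inj : injection V) t v p :
  local_injection inj t v = Some p <-> inj t = Some (v, p).
Proof.
rewrite /local_injection; case: (inj t) => [[u q]|] //.
by case: eqP => [->|uv]; [split=> [[->]|[->]] | split=> // -[/uv]].
Qed.

Lemma arrivalP (V : finType) (inj : injection V) i v :
  reflect (exists p, inj i.+1 = Some (v, p)) (arrival inj i v).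
Proof.
rewrite /arrival; case E: local_injection => [p|]; constructor.
  by exists p; apply/local_injectionP.
by case=> p /local_injectionP; rewrite E.
Qed.

Section Optimum.
Context {R : realType} {V : finType} {e : rel V} {A : V -> V * V -> R}.
Context {S : {set V}} {inj : injection V}.
Hypothesis inj_legal : legal_injection S inj.

Lemma legal_unique i j u v p :
  inj i.+1 = Some (u, p) -> inj j.+1 = Some (v, p) -> i = j /\ u = v.
Proof.
case: inj_legal => _ H Hi Hj; have [ij] := H i.+1 j.+1 u v p isT isT Hi Hj.
by split=> //; move: Hi; rewrite ij Hj => -[].
Qed.

Lemma has_packet_mono x t t' v p : t <= t' ->
  has_packet e A inj x t v p -> has_packet e A inj x t' v p.
Proof.
by move=> /subnK <-; elim: (t' - t) => // d IH /IH Hk; rewrite addSn /= Hk.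
Qed.

Lemma has_packet_injected x t v p : valid_execution e A inj x ->
  has_packet e A inj x t v p -> exists i u, i < t /\ inj i.+1 = Some (u, p).
Proof.
move=> Hx; elim: t v => // t IH v /= /or3P[/IH [i [u [Hi Hu]]]|/eqP Hp|].
- by exists i, u; split=> //; apply: ltnW.
- by exists t, v.
case/existsP=> u /andP[_ /eqP /Hx [/IH [i [w [Hi Hw]]]|Hp]].
- by exists i, w; split=> //; apply: ltnW.
- by exists t, u.
Qed.

(** Between [lo] and [hi + B], OPT brings every packet of the batch from its source to all nodes.
    Its other packets become noise, which leaves the interference unchanged. *)
Lemma deliverable_opt x B lo hi : valid_execution e A inj x ->
  (forall i v p, 0 < i -> inj i = Some (v, p) -> delivered e A inj x (i + B) p) ->
  deliverable e A (batch (arrival inj) lo hi) (hi + B - lo).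
Proof.
move=> Hx HB; set ev := events (arrival inj) lo hi.
pose carries p i := if inj i.+1 is Some (_, q) then q == p else false.
(* A packet injected outside the range gets no name, or the number [size (ev s)], which lies beyond
   the batch. *)
pose name p := if inj (find (carries p) (iota 0 hi)).+1 is Some (s, _)
  then Some (s, index (find (carries p) (iota 0 hi)) (ev s)) else None.
have nameE i s p : i < hi -> inj i.+1 = Some (s, p) -> name p = Some (s, index i (ev s)).
  move=> Hi Hp; have Hh : has (carries p) (iota 0 hi).
    by apply/hasP; exists i; rewrite ?mem_iota // /carries Hp.
  have Hf : find (carries p) (iota 0 hi) < hi by move: (Hh); rewrite has_find size_iota.
  have := nth_find 0 Hh; rewrite nth_iota // add0n /name.
  move: (find _ _) => j; rewrite /carries.
  case Ej: (inj j.+1) => [[s' q]|] // /eqP qp; subst q.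
  by have [<- <-] := legal_unique Hp Ej.
pose y t u := omap (obind name) (x (lo + t).+1 u).
have Hy i s p t v : lo <= i < hi -> inj i.+1 = Some (s, p) ->
    has_packet e A inj x (lo + t) v p -> knows e A y t v (s, index i (ev s)).
  case/andP=> Hlo Hhi Hp; elim: t v => [|t IH] v.
    (* No node has [p] before its injection, so the base case is vacuous. *)
    rewrite addn0 => /(has_packet_injected Hx) [j [u [Hj Hu]]].
    by have [ij _] := legal_unique Hp Hu; rewrite ij leqNgt Hj in Hlo.
  have own u : inj (lo + t).+1 = Some (u, p) -> knows e A y t u (s, index i (ev s)).
    move=> Hu; have [_ <-] := legal_unique Hp Hu.
    by apply: (@knows_mono _ _ _ _ _ 0) => /=.
  rewrite addnS => /or3P[/IH Hv|/eqP /own Hv|/existsP[u /andP[Hr /eqP Hu]]].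
  - by apply: knows_mono Hv.
  - by apply: knows_mono Hv.
  rewrite /=; apply/orP; right; apply/existsP; exists u.
  have -> : transmitters (y t) = transmitters (x (lo + t).+1).
    by apply/setP => w; rewrite !inE /y; case: (x _ w).
  rewrite Hr /y Hu /= (nameE i s p) // eqxx /=.
  by case: (Hx _ _ _ Hu) => [/IH|/own].
exists y => v s k Hk; have Hi := mem_nth 0 Hk.
have := Hi; rewrite mem_events => /andP[/arrivalP[p Hp] Hlh].
rewrite -[k](@index_uniq _ 0 k (ev s)) ?filter_uniq ?iota_uniq //.
have [Hlo Hhi] := andP Hlh; apply: (Hy _ _ _ _ _ Hlh Hp); rewrite subnKC; last first.
  by apply: leq_trans Hlo (leq_trans (ltnW Hhi) (leq_addr _ _)).
by apply: has_packet_mono (forallP (HB _ _ _ (ltn0Sn _) Hp) v); rewrite leq_add2r.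
Qed.

End Optimum.

(** * The protocol *)

(** A phase starts at window [phase_start] and delivers the packets selected in slots
    [phase_lo <= i < phase_hi]. *)
Record phase := Phase { phase_start : nat; phase_lo : nat; phase_hi : nat }.

(** A selected packet is identified by its slot of injection, in [heard] (who selected when) and in
    [held] (packets in possession). *)
Record node_state (V : finType) := NodeState {
  clock : nat;
  injected : nat;
  heard : nat -> V -> bool;
  held : nat -> option packet
}.

Section Protocol.
Context {R : realType} {V : finType} (e : rel V) (A : V -> V * V -> R).
Hypothesis e_irr : irreflexive e.
Hypothesis e_conn : forall u v, connect e u v.
Variable m : nat.
Implicit Types f g : nat -> V -> bool.

Lemma deliverable_ex c : exists W, `[< deliverable e A c W >].
Proof.
eexists; apply/asboolP; apply: deliverable_le (leqnn _) (deliverable_cst A e_irr e_conn (\max_s c s)).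
by move=> s; apply: leq_bigmax.
Qed.

Definition batch_time c : nat := ex_minn (deliverable_ex c).

Lemma batch_time_le c W : deliverable e A c W -> batch_time c <= W.
Proof. by move=> /asboolP H; rewrite /batch_time; case: ex_minnP => W' _; apply. Qed.

Lemma batch_schedule_ex c :
  exists x, forall v s k, k < c s -> knows e A x (batch_time c) v (s, k).
Proof. by rewrite /batch_time; case: ex_minnP => W' /asboolP[x Hx] _; exists x. Qed.

(** Chosen once and for all, so that nodes agreeing on the batch follow the same schedule. *)
Definition batch_sched c := sval (cid (batch_schedule_ex c)).

Lemma batch_schedP c v s k :
  k < c s -> knows e A (batch_sched c) (batch_time c) v (s, k).
Proof. exact: (svalP (cid (batch_schedule_ex c))). Qed.

(* A window starts with [half] control slots, followed by [half] data slots. *)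
Definition half : nat := (#|V| * #|V|).+1.
Definition window : nat := half + half.

Lemma ltn_half : #|V| * #|V| < half. Proof. by []. Qed.

Lemma window_gt0 : 0 < window. Proof. by []. Qed.

Lemma windowE : window = half + half. Proof. by []. Qed.

Lemma window_half : window - half = half. Proof. by rewrite /window addnK. Qed.

Lemma leq_half_window : half <= window. Proof. by rewrite leq_addr. Qed.

Opaque half window.

(* During window [k] all nodes know the events before slot [k.-1 * window]:
   those of window [k.-1] are still being flooded. *)
Fixpoint phase_at f (k : nat) : phase :=
  if k isn't k'.+1 then Phase 0 0 0 else
  let p := phase_at f k' in
  if batch_time (batch f (phase_lo p) (phase_hi p)) <= (k - phase_start p) * half
  then Phase k (phase_hi p) (k' * window) else p.

Lemma phase_hi_le f k : phase_hi (phase_at f k) <= k.-1 * window.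
Proof.
elim: k => //= k IH; case: ifP => //= _.
by apply: leq_trans IH _; rewrite leq_mul2r leq_pred orbT.
Qed.

Lemma phase_lo_hi f k : phase_lo (phase_at f k) <= phase_hi (phase_at f k).
Proof.
elim: k => //= k IH; case: ifP => //= _.
by apply: leq_trans (phase_hi_le f k) _; rewrite leq_mul2r leq_pred orbT.
Qed.

Lemma phase_start_le f k : phase_start (phase_at f k) <= k.
Proof. by elim: k => //= k IH; case: ifP => //= _; apply: leqW. Qed.

(** The phase of a window depends only on events that all nodes know by then. *)
Lemma eq_phase_at f g k :
  (forall i s, i < k.-1 * window -> f i s = g i s) -> phase_at f k = phase_at g k.
Proof.
elim: k => //= k IH Hfg.
have Hp i s : i < k.-1 * window -> f i s = g i s.
  by move=> Hi; apply: Hfg; apply: leq_trans Hi _; rewrite leq_mul2r leq_pred orbT.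
rewrite -(IH Hp); set p := phase_at f k.
rewrite (@eq_batch _ f g) // => i s Hi; apply: Hp.
by apply: leq_trans Hi (phase_hi_le f k).
Qed.

(** The data halves of the windows of a phase, put end to end, run the schedule of its batch. Names
    [(s, j)] are translated into slots of injection. *)
Definition plan f (t : nat) (u : V) : option (option nat) :=
  let k := t %/ window in
  let p := phase_at f k in
  omap (obind (fun q => onth (events f (phase_lo p) (phase_hi p) q.1) q.2))
    (batch_sched (batch f (phase_lo p) (phase_hi p))
       ((k - phase_start p) * half + (t %% window - half)) u).

Lemma eq_plan f g t u :
  (forall i s, i < (t %/ window).-1 * window -> f i s = g i s) ->
  plan f t u = plan g t u.
Proof.
move=> Hfg; rewrite /plan -(eq_phase_at Hfg).
set p := phase_at f _; have Hp := phase_hi_le f (t %/ window).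
have Hfg' i s : i < phase_hi p -> f i s = g i s by move=> Hi; apply: Hfg; apply: leq_trans Hi Hp.
rewrite (@eq_batch _ f g) //; case: (batch_sched _ _ u) => [[[s k]|]|] //=.
by rewrite (@eq_events _ f g) // => i; apply: Hfg'.
Qed.

(** Events of the previous window, given by node and offset: this keeps the alphabet finite. *)
Definition control := {set V * 'I_window}.

Definition gather (st : node_state V) : control :=
  [set q : V * 'I_window | heard st ((clock st %/ window).-1 * window + q.2) q.1].

Definition act (v : V) (st : node_state V) (o : option packet) :
    option (option packet * control) :=
  let t := clock st in
  if t %% window < half
  then (if round_robin (t %% window) v then Some (None, gather st) else None)
  else omap (fun oi => (obind (held st) oi, finset.set0)) (plan (heard st) t v).

Definition selects (st : node_state V) (o : option packet) : bool :=
  isSome o && (m %| injected st).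

(** The slot under which a received packet is stored is not transmitted: the receiver reads it off
    the plan of the sender, which it computes itself. *)
Definition next (v : V) (st : node_state V) (o : option packet)
    (rcv : {ffun V -> option (option packet * control)}) : node_state V :=
  let t := clock st in
  NodeState t.+1 (injected st + isSome o)
    (fun i w => [|| heard st i w, [&& i == t, w == v & selects st o] |
       [exists u, exists j : 'I_window,
          (i == (t %/ window).-1 * window + j) &&
          (if rcv u is Some (_, M) then (w, j) \in M else false)]])
    (fun i => if held st i is Some p then Some p
      else if (i == t) && selects st o then o
      else ohead (pmap (fun u => if plan (heard st) t u == Some (Some i)
                                 then obind fst (rcv u) else None) (enum V))).

Definition sampling_protocol : protocol V :=
  Protocol (fun=> NodeState 0 0 (fun _ _ => false) (fun=> None)) act next.

(** * Invariants of a run *)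

Section Run.
Variable inj : injection V.

Definition selected (i : nat) (v : V) : bool :=
  arrival inj i v && (m %| count (arrival inj ^~ v) (iota 0 i)).

Definition state_at (t : nat) : V -> node_state V :=
  run_state e A sampling_protocol inj t.
Definition acts (t : nat) : V -> option (option packet * control) :=
  actions_from (P := sampling_protocol) inj (state_at t) t.+1.
Definition rcv (t : nat) (v : V) : {ffun V -> option (option packet * control)} :=
  [ffun u => if receives e A (transmitters (acts t)) u v then acts t u else None].
Notation st := state_at.
Notation alg := (run e A sampling_protocol inj).

Lemma state_atS t v : st t.+1 v = next v (st t v) (local_injection inj t.+1 v) (rcv t v).
Proof. by []. Qed.

Lemma runS t u : alg t.+1 u = omap fst (acts t u).
Proof. by []. Qed.

Opaque state_at.

Lemma run_transmitters t : transmitters (alg t.+1) = transmitters (acts t).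
Proof. by apply/setP => u; rewrite !inE runS; case: (acts t u). Qed.

Lemma clockE t v : clock (st t v) = t.
Proof. by elim: t v => // t IH v; rewrite state_atS /= IH. Qed.

Lemma injectedE t v : injected (st t v) = count (arrival inj ^~ v) (iota 0 t).
Proof.
elim: t v => // t IH v.
by rewrite state_atS -[in RHS]addn1 iotaD count_cat /= IH addn0 add0n.
Qed.

Lemma selectsE t v : selects (st t v) (local_injection inj t.+1 v) = selected t v.
Proof. by rewrite /selects injectedE. Qed.

Lemma rcv_some t v u a : rcv t v u = Some a ->
  receives e A (transmitters (acts t)) u v /\ acts t u = Some a.
Proof. by rewrite ffunE; case: ifP. Qed.

Lemma heard_mono t t' v i w : t <= t' -> heard (st t v) i w -> heard (st t' v) i w.
Proof.
by move=> /subnK <-; elim: (t' - t) => // d IH /IH Hk; rewrite addSn state_atS /= Hk.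
Qed.

Lemma heard_own i w : selected i w -> heard (st i.+1 w) i w.
Proof. by move=> Hs; rewrite state_atS /= clockE !eqxx selectsE Hs orbT. Qed.

Lemma heard_selected t v i w : heard (st t v) i w -> selected i w && (i < t).
Proof.
elim: t v i w => // t IH v i w; rewrite state_atS /= clockE.
case/or3P=> [/IH /andP[-> Ht]|/and3P[/eqP -> /eqP ->]|].
- exact: ltnW.
- by rewrite selectsE => ->; rewrite ltnSn.
case/existsP=> u /existsP[j /andP[/eqP ->]].
case Er: (rcv t v u) => [[q M]|] //; have [_] := rcv_some Er.
rewrite /acts /actions_from /= /act clockE; case: ifP => _.
  by case: ifP => // _ [_ <-]; rewrite inE /= clockE => /IH /andP[-> /ltnW].
by case: plan => //= oi [_ <-]; rewrite inE.
Qed.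

Lemma control_transmitters t u :
  t %% window < half -> round_robin (t %% window) u -> transmitters (acts t) = [set u].
Proof.
move=> Ht Hu; apply: round_robin_transmitters Hu _ => v.
by rewrite /acts /actions_from /= /act clockE Ht; case: ifP.
Qed.

(** The control half of window [k.+1] floods the events of window [k], with a single transmitter per
    slot and thus no collision. *)
Lemma heard_flooded k i w v : k * window <= i < k.+1 * window -> selected i w ->
  heard (st (k.+1 * window + half) v) i w.
Proof.
case/andP=> Hk1 Hk2 Hs.
apply: (@round_robin_flood _ e e_conn (fun r v => heard (st (k.+1 * window + r) v) i w) w) => //=.
- by move=> t {}v; apply: heard_mono; rewrite leq_add2l.
- move=> t u {}v Ht Hr euv Hu.
  have Hth : t < half by apply: ltn_trans Ht ltn_half.
  have Htw : t < window by apply: leq_trans Hth leq_half_window.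
  have Em : (k.+1 * window + t) %% window = t by rewrite modnMDl modn_small.
  have Ed : (k.+1 * window + t) %/ window = k.+1 by rewrite divnMDl ?window_gt0 // divn_small ?addn0.
  have Hi : i - k * window < window by rewrite ltn_subLR // -mulSnr.
  rewrite addnS state_atS /= clockE Ed /=; apply/or3P; apply: Or33.
  apply/existsP; exists u; apply/existsP; exists (Ordinal Hi).
  rewrite /= subnKC // eqxx ffunE (control_transmitters (u := u)) ?Em // receives_alone //.
  by rewrite /acts /actions_from /= /act clockE Em Hth Hr inE /= clockE Ed /= subnKC.
- by rewrite addn0; apply: heard_mono (heard_own Hs).
Qed.

Lemma heardE t v i w : i < (t %/ window).-1 * window -> heard (st t v) i w = selected i w.
Proof.
move=> Hi; apply/idP/idP => [/heard_selected /andP[] //|Hs].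
apply: heard_mono (@heard_flooded (i %/ window) _ _ _ _ Hs); last first.
  by rewrite leq_divM /= -ltn_divLR.
rewrite -ltn_divLR // in Hi.
apply: (@leq_trans ((t %/ window) * window)); last exact: leq_divM.
apply: (@leq_trans ((i %/ window).+2 * window)).
  by rewrite [X in _ <= X]mulSnr leq_add2l leq_half_window.
by rewrite leq_mul2r; apply/orP; right; move: (t %/ _) (i %/ _) Hi => a b; lia.
Qed.

(** Whatever it has heard, each node plans as if it knew the true pattern: this coordinates the
    nodes. *)
Lemma planE t v u : plan (heard (st t v)) t u = plan selected t u.
Proof. by apply: eq_plan => i s; apply: heardE. Qed.

Lemma ohead_pmap_some (T T' : Type) (h : T -> option T') s p :
  ohead (pmap h s) = Some p -> exists u, h u = Some p.
Proof. by elim: s => //= x s IH; case E: (h x) => [y|] //= [<-]; exists x. Qed.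

Lemma ohead_pmap (T : eqType) (T' : Type) (h : T -> option T') s u :
  u \in s -> isSome (h u) -> isSome (ohead (pmap h s)).
Proof.
elim: s => //= x s IH; rewrite inE => /orP[/eqP <-|/IH Hu /Hu Hs]; first by case: (h u).
by case: (h x).
Qed.

(** A received packet is stored under the right slot, since sender and receiver share the plan and
    control messages carry no packet. *)
Lemma heldS t v i p : held (st t.+1 v) i = Some p ->
  [\/ held (st t v) i = Some p,
      [/\ i = t, selected t v & inj t.+1 = Some (v, p)] |
      exists u, [/\ receives e A (transmitters (acts t)) u v,
                    alg t.+1 u = Some (Some p),
                    plan selected t u = Some (Some i) & held (st t u) i = Some p]].
Proof.
rewrite state_atS /= clockE selectsE; case E: (held (st t v) i) => [q|].
  by move=> <-; apply: Or31.
case: ifP => [/andP[/eqP -> Hs] /local_injectionP Hp|_]; first by apply: Or32.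
move=> Ho; have [u] := ohead_pmap_some Ho; case: eqP => //; rewrite planE => Hpl.
case Er: (rcv t v u) => [[q M]|] //= {}Ho; subst q; apply: Or33; exists u.
have [Hr Ha] := rcv_some Er; split=> //.
  by rewrite runS Ha.
move: Ha; rewrite /acts /actions_from /= /act clockE; case: ifP => _.
  by case: ifP.
by rewrite planE Hpl => -[].
Qed.

Lemma run_held t u p : alg t.+1 u = Some (Some p) ->
  exists i, held (st t u) i = Some p.
Proof.
rewrite runS /acts /actions_from /= /act clockE; case: ifP => _; first by case: ifP.
by case: plan => [[i|]|] //= [Hp]; exists i.
Qed.

Lemma held_has_packet t v i p : held (st t v) i = Some p ->
  has_packet e A inj alg t v p.
Proof.
elim: t v i => // t IH v i /heldS[/IH Hv|[_ _ Hv]|[u [Hr Hu _ _]]].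
- by rewrite [has_packet _ _ _ _ _ _ _]/= Hv.
- by rewrite [has_packet _ _ _ _ _ _ _]/= Hv eqxx orbT.
- rewrite [has_packet _ _ _ _ _ _ _]/=; apply/or3P; apply: Or33; apply/existsP; exists u.
  by rewrite run_transmitters Hr Hu eqxx.
Qed.

Lemma held_selected t v i p : held (st t v) i = Some p ->
  exists s, selected i s /\ inj i.+1 = Some (s, p).
Proof.
elim: t v => // t IH v /heldS[/IH //|[-> Hs Hv]|[u [_ _ _ /IH //]]].
by exists v.
Qed.

(** Only held packets are transmitted, so a packet that is not selected never leaves its source. *)
Lemma has_packet_run t v p :
  has_packet e A inj alg t v p ->
  (exists i, inj i.+1 = Some (v, p)) \/ (exists i s, selected i s /\ inj i.+1 = Some (s, p)).
Proof.
elim: t v => // t IH v; rewrite [has_packet _ _ _ _ _ _ _]/=.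
case/or3P=> [/IH //|/eqP Hp|/existsP[u /andP[_ /eqP /run_held[i /held_selected Hi]]]].
  by left; exists t.
by right; exists i.
Qed.

Lemma held_mono t t' v i : t <= t' -> isSome (held (st t v) i) -> isSome (held (st t' v) i).
Proof.
move=> /subnK <-; elim: (t' - t) => // d IH /IH; rewrite addSn state_atS /=.
by case: (held _ i).
Qed.

Lemma held_own i v : selected i v -> isSome (held (st i.+1 v) i).
Proof.
move=> Hs; rewrite state_atS /= clockE eqxx selectsE Hs /=; case: (held _ i) => //.
by case/andP: Hs.
Qed.

Lemma data_acts t u : half <= t %% window ->
  acts t u = omap (fun oi => (obind (held (st t u)) oi, finset.set0)) (plan selected t u).
Proof. by move=> Ht; rewrite /acts /actions_from /= /act clockE ltnNge Ht planE. Qed.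

Lemma held_received t u v i : half <= t %% window ->
  receives e A (transmitters (acts t)) u v -> plan selected t u = Some (Some i) ->
  isSome (held (st t u) i) -> isSome (held (st t.+1 v) i).
Proof.
move=> Ht Hr Hpl Hu; rewrite state_atS /= clockE; case E: (held (st t v) i) => [//|].
case: ifP => [/andP[_ /andP[]] //|_]; apply: (@ohead_pmap _ _ _ _ u); first by rewrite mem_enum.
by rewrite planE Hpl eqxx ffunE Hr data_acts // Hpl.
Qed.

(** The invariant tying the run to the ideal schedule at offset [r] of window [k]. By truncated
    subtraction, the schedule stands still during the control half. *)
Definition on_schedule k r := forall u s j i, let p := phase_at selected k in
  knows e A (batch_sched (batch selected (phase_lo p) (phase_hi p)))
    ((k - phase_start p) * half + (r - half)) u (s, j) ->
  onth (events selected (phase_lo p) (phase_hi p) s) j = Some i ->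
  isSome (held (st (k * window + r) u) i).

(** In the data half the transmitters are exactly those of the schedule, noise included, so
    receptions agree. *)
Lemma on_schedule_step k r : r < window -> on_schedule k r -> on_schedule k r.+1.
Proof.
rewrite /on_schedule; set p := phase_at selected k.
set x := batch_sched _ => Hr IH u s j i /= + Hi; rewrite addnS.
have Em : (k * window + r) %% window = r by rewrite modnMDl modn_small.
have Ed : (k * window + r) %/ window = k by rewrite divnMDl ?window_gt0 // divn_small ?addn0.
have IHu v : knows e A x ((k - phase_start p) * half + (r - half)) v (s, j) ->
    isSome (held (st (k * window + r) v) i) by move=> /IH; apply.
case: (ltnP r half) => Hrh.
  have -> : r.+1 - half = r - half by lia.
  by move=> /IHu; apply: held_mono.
rewrite subSn // addnS => /= /orP[/IHu|/existsP[v /and3P[Hrec /eqP Hx /IHu Hv]]].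
  exact: held_mono.
apply: (@held_received _ v) Hv; rewrite ?Em //; last first.
  by rewrite /plan Ed Em -/p -/x Hx /= Hi.
suff -> : transmitters (acts (k * window + r)) =
    transmitters (x ((k - phase_start p) * half + (r - half))) by [].
apply/setP => w; rewrite !inE data_acts ?Em //= /plan Ed Em -/p -/x.
by case: (x _ w).
Qed.

Lemma on_schedule_window k r : on_schedule k 0 -> r <= window -> on_schedule k r.
Proof.
by move=> H0; elim: r => // r IH Hr; apply: on_schedule_step => //; apply/IH/ltnW.
Qed.

(** Either a phase starts, and sources hold their own packets of the batch, or the schedule resumes
    where the previous window left it. *)
Lemma on_schedule_start k : on_schedule k 0.
Proof.
have new k' u s j i : let p := phase_at selected k' in
    s == u -> onth (events selected (phase_lo p) (phase_hi p) s) j = Some i ->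
    isSome (held (st (k' * window + 0) u) i).
  move=> p /eqP <- Hi.
  have : i \in events selected (phase_lo p) (phase_hi p) s by apply/onthP; exists j.
  rewrite mem_events => /andP[Hs /andP[_ Hhi]].
  rewrite addn0; apply: held_mono (held_own Hs).
  apply: leq_trans Hhi (leq_trans (phase_hi_le _ _) _).
  by rewrite leq_mul2r leq_pred orbT.
elim: k => [|k IHk] u s j i; first exact: new.
have := @new k.+1 u s j i; rewrite /=; set p := phase_at selected k.
case: ifP => Hc /= Hnew; first by rewrite subnn; apply: Hnew.
rewrite sub0n addn0 subSn ?phase_start_le // mulSnr => Hk Hi.
have := on_schedule_window IHk (leqnn _); rewrite /on_schedule -/p.
move=> /(_ u s j i); rewrite addn0 -mulSnr; apply=> //.
by rewrite window_half.
Qed.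

(** Successive phases cover successive ranges of slots, and a phase ends only after its schedule is
    completed. *)
Lemma held_before_phase k i s v :
  selected i s -> i < phase_lo (phase_at selected k) -> isSome (held (st (k * window) v) i).
Proof.
elim: k => // k IHk Hs /=.
set p := phase_at selected k; case: ifP => Hc /= Hi; last first.
  by apply: held_mono (IHk Hs Hi); rewrite leq_mul2r leqnSn orbT.
case: (ltnP i (phase_lo p)) => Hlo.
  by apply: held_mono (IHk Hs Hlo); rewrite leq_mul2r leqnSn orbT.
have /onthP[j Hj] : i \in events selected (phase_lo p) (phase_hi p) s.
  by rewrite mem_events Hs Hlo.
have := on_schedule_window (@on_schedule_start k) (leqnn window).
move=> /(_ v s j i); cbv zeta; rewrite -/p window_half -mulSnr.
rewrite -[_ * window + window]mulSnr -subSn ?phase_start_le //.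
apply=> //; apply: knows_mono Hc _; apply: batch_schedP.
by rewrite /batch -onthTE Hj.
Qed.

End Run.
End Protocol.

(** * Latency and throughput *)

Lemma count_iotaS (P : pred nat) t : count P (iota 0 t.+1) = count P (iota 0 t) + P t.
Proof. by rewrite -[in LHS]addn1 iotaD count_cat /= addn0 add0n. Qed.

Lemma count_iota_delay (P Q : pred nat) lat t :
  (forall i, i + lat < t -> Q i -> P i) ->
  count Q (iota 0 (t - lat)) <= count P (iota 0 t).
Proof.
move=> HPQ; rewrite -{2}(subnKC (leq_subr lat t)) iotaD count_cat.
apply: leq_trans (leq_addr _ _); rewrite -!size_filter.
apply: uniq_leq_size; first by rewrite filter_uniq ?iota_uniq.
move=> i; rewrite !mem_filter mem_iota add0n => /andP[Qi Hi].
by rewrite Hi andbT; apply: HPQ Qi; lia.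
Qed.

Lemma count_iota_lag (Q : pred nat) lat t :
  count Q (iota 0 t) <= count Q (iota 0 (t - lat)) + lat.
Proof.
rewrite -{1}(subnKC (leq_subr lat t)) iotaD count_cat leq_add2l.
by apply: leq_trans (count_size _ _) _; rewrite size_iota; lia.
Qed.

Lemma count_sum_sources (V : finType) (P : pred nat) (Q : nat -> V -> bool) r :
  (forall i, P i = \sum_s Q i s :> nat) -> count P r = \sum_s count (Q ^~ s) r.
Proof.
move=> HPQ; elim: r => [|i r IH] /=; first by rewrite big1.
by rewrite IH HPQ big_split.
Qed.

Section Throughput.
Context {R : realType} {V : finType} (e : rel V) (A : V -> V * V -> R).
Hypothesis e_irr : irreflexive e.
Hypothesis e_conn : forall u v, connect e u v.
Variables (m : nat) (S : {set V}) (inj : injection V).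
Hypothesis m_gt0 : 0 < m.
Hypothesis inj_legal : legal_injection S inj.

Notation selected := (selected m inj).
Notation alg := (run e A (sampling_protocol A e_irr e_conn m) inj).
Notation st := (state_at A e_irr e_conn m inj).
Notation half := (@half V).
Notation window := (@window V).

Lemma valid_sampling inj' :
  valid_execution e A inj' (run e A (sampling_protocol A e_irr e_conn m) inj').
Proof. by move=> t u p /run_held[i /held_has_packet]; left. Qed.

(** The first of every [m] arrivals is selected, so [m] times the selections is the number of
    arrivals rounded up to a multiple of [m]. *)
Lemma count_selected s t :
  count (arrival inj ^~ s) (iota 0 t) <= m * count (selected ^~ s) (iota 0 t)
    < count (arrival inj ^~ s) (iota 0 t) + m.
Proof.
elim: t => [|t]; first by rewrite /= muln0 add0n.
rewrite !count_iotaS.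
have -> : selected t s = arrival inj t s && (m %| count (arrival inj ^~ s) (iota 0 t)) by [].
set a := count _ _; set c := count _ _.
case: (arrival inj t s) => /= [|]; last by rewrite !addn0.
case/andP=> H1 H2; case: (boolP (m %| a)) => [/dvdnP[q]|Hn] /=.
  rewrite mulnC => Eq; rewrite Eq leq_pmul2l // in H1.
  rewrite Eq -mulnSr ltn_pmul2l // ltnS in H2.
  have -> : c = q by apply/eqP; rewrite eqn_leq H2.
  by rewrite Eq mulnDr muln1; apply/andP; split; lia.
have : a != m * c by apply: contraNneq Hn => ->; apply: dvdn_mulr.
by rewrite addn0 => Ha; apply/andP; split; lia.
Qed.

Lemma batch_selected_le lo hi s : lo <= hi ->
  m * batch selected lo hi s <= batch (arrival inj) lo hi s + m.
Proof.
move=> Hlh; have := batch_iota (arrival inj) s Hlh; have := batch_iota selected s Hlh.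
have := count_selected s lo; have := count_selected s hi.
move=> /andP[_ H1] /andP[H2 _] E1 E2; move: H1 H2; rewrite E1 E2 mulnDr; lia.
Qed.

(** * Bounded latency of the selected packets *)

Section Latency.
Variables (opt : execution V) (B L0 : nat).
Hypothesis opt_valid : valid_execution e A inj opt.
Hypothesis opt_latency : forall i v p,
  0 < i -> inj i = Some (v, p) -> delivered e A inj opt (i + B) p.
Hypothesis speedup : forall a c W, (forall s, m * c s <= a s) ->
  deliverable e A a W -> deliverable e A c (W %/ 4 + L0).

Let flood := 1 * (#|V| * (#|V| * #|V|)).

(** Rounding may cost one extra packet per source. Without it [speedup] applies to the batch of OPT;
    these extra packets are delivered naively. *)
Lemma batch_time_selected lo hi : lo <= hi ->
  batch_time A e_irr e_conn (batch selected lo hi) <= (hi - lo + B) %/ 4 + L0 + flood.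
Proof.
move=> Hlh; apply: batch_time_le.
have Ha := deliverable_opt inj_legal lo hi opt_valid opt_latency.
have Hc : deliverable e A (fun s => (batch selected lo hi s).-1) ((hi + B - lo) %/ 4 + L0).
  apply: speedup Ha => s; have := batch_selected_le s Hlh.
  by case: (batch selected lo hi s) => [|c] /=; [rewrite muln0|rewrite mulnS; lia].
apply: deliverable_le (deliverableD Hc (deliverable_cst A e_irr e_conn 1)) => [s|].
  by case: (batch _ _ _ s) => //= c; rewrite addn1.
by rewrite -addnBAC.
Qed.

(* A batch injected over [backlog] slots takes at most [max_time] data slots,
   hence a phase of at most [backlog] slots, which is the range of the next
   batch. *)
Let backlog := B + 4 * L0 + 4 * flood + 2 * window.
Let max_time := (backlog + B) %/ 4 + L0 + flood.

Lemma phase_bounds k : let p := phase_at A e_irr e_conn selected k in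
  [/\ phase_hi p - phase_lo p <= backlog, (k - phase_start p) * half <= max_time &
      phase_hi p = (phase_start p).-1 * window].
Proof.
elim: k => [|k [IH1 IH2 IH3]] //=.
have Hlh := phase_lo_hi A e_irr e_conn selected k.
have Hst := phase_start_le A e_irr e_conn selected k.
set p := phase_at _ _ _ _ k in IH1 IH2 IH3 Hlh Hst *.
case: ifP => Hc /=; split=> //.
- rewrite IH3 -mulnBl; apply: (@leq_trans ((k - phase_start p).+1 * window)).
    by rewrite leq_mul2r; apply/orP; right; lia.
  (* The range is at most [2 * max_time + window], as half of the slots are data slots; [backlog] is
     the fixed point of this bound, up to rounding. *)
  rewrite mulSnr {1}windowE mulnDr; move: IH2; rewrite /max_time /backlog; lia.
- by rewrite subnn.
- move/negbT: Hc; rewrite -ltnNge => Hc; apply: leq_trans (ltnW Hc) _.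
  apply: leq_trans (batch_time_selected Hlh) _.
  by rewrite /max_time !leq_add2r leq_div2r // leq_add2r.
Qed.

(** The current batch spans at most [backlog] slots and ends less than [max_time.+2] windows before
    [t]; older selections belong to completed phases. *)
Lemma selected_held : exists lat, forall i s t v,
  selected i s -> i + lat <= t -> isSome (held (st t v) i).
Proof.
exists (backlog + max_time.+2 * window) => i s t v Hs Ht.
have [H1 H2 H3] := phase_bounds (t %/ window).
set p := phase_at _ _ _ _ _ in H1 H2 H3.
have half0 : 0 < half := leq_ltn_trans (leq0n _) (@ltn_half V).
have H4 : t %/ window - phase_start p <= max_time.
  by apply: leq_trans H2; apply: leq_pmulr.
apply: (@held_mono _ _ _ _ _ _ _ _ (t %/ window * window)); first exact: leq_divM.
apply: held_before_phase Hs _; rewrite -/p.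
have Hw : t < (t %/ window).+1 * window by rewrite -ltn_divLR // window_gt0.
have : (t %/ window).+1 * window <= ((phase_start p).-1 + max_time.+2) * window.
  by rewrite leq_mul2r; apply/orP; right; lia.
rewrite mulnDl -H3; lia.
Qed.

Lemma selected_delivered : exists lat, forall i s p t,
  selected i s -> inj i.+1 = Some (s, p) -> i + lat <= t -> delivered e A inj alg t p.
Proof.
have [lat Hlat] := selected_held; exists lat => i s p t Hs Hp Ht.
apply/forallP => v; have := Hlat i s t v Hs Ht.
case E: (held _ i) => [q|] // _; have [s' [_]] := held_selected E.
by rewrite Hp => -[_ ->]; apply: held_has_packet E.
Qed.

End Latency.

Definition num_injected (t : nat) : nat := count (fun i => isSome (inj i.+1)) (iota 0 t).

Definition num_selected (t : nat) : nat :=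
  count (fun i => if inj i.+1 is Some (s, _) then selected i s else false) (iota 0 t).

Lemma num_deliveredE x t : num_delivered e A inj x t =
  count (fun i => if inj i.+1 is Some (_, p) then delivered e A inj x t p else false) (iota 0 t).
Proof. by rewrite /num_delivered -[1]addn0 iotaDl count_map. Qed.

Lemma num_delivered_injected x t : num_delivered e A inj x t <= num_injected t.
Proof. by rewrite num_deliveredE; apply: sub_count => i; case: (inj _) => [[]|]. Qed.

(** An unselected packet misses any node other than its source. On a single node every packet is
    delivered at once, whence the case [m = 1]. *)
Lemma num_delivered_selected t : 1 < #|V| \/ m = 1 ->
  num_delivered e A inj alg t <= num_selected t.
Proof.
move=> Vm; rewrite num_deliveredE; apply: sub_count => i /=.
case Ei: (inj i.+1) => [[s p]|] // Hd.
case: Vm => [/card_gt1P[v1 [v2 [_ _ v12]]]|m1]; last first.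
  by rewrite /selected m1 dvd1n andbT; apply/arrivalP; exists p.
have [v vs] : exists v, v != s.
  by case: (v1 =P s) => [<-|/eqP ?]; [exists v2; rewrite eq_sym | exists v1].
have /has_packet_run[[j Hj]|[j [u [Hu Hj]]]] := forallP Hd v.
  by have [_ sv] := legal_unique inj_legal Ei Hj; rewrite sv eqxx in vs.
by have [-> ->] := legal_unique inj_legal Ei Hj.
Qed.

Lemma num_selected_bounds t :
  num_injected t <= m * num_selected t <= num_injected t + m * #|V|.
Proof.
have sumE (F : V -> bool) u : (forall s, s != u -> F s = false) -> \sum_s F s = F u.
  by move=> HF; rewrite (bigD1 u) //= big1 ?addn0 // => s /HF ->.
have -> : num_injected t = \sum_s count (arrival inj ^~ s) (iota 0 t).
  apply: count_sum_sources => i; rewrite /arrival /local_injection.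
  case: (inj i.+1) => [[u p]|]; last by rewrite big1.
  rewrite (sumE _ u) ?eqxx // => s su; rewrite eq_sym (negbTE su) //.
have -> : num_selected t = \sum_s count (selected ^~ s) (iota 0 t).
  apply: count_sum_sources => i; case E: (inj i.+1) => [[u p]|]; last first.
    by rewrite big1 // => s _; rewrite /selected /arrival /local_injection E.
  rewrite (sumE _ u) // => s su.
  by rewrite /selected /arrival /local_injection E eq_sym (negbTE su).
rewrite big_distrr /= mulnC -sum_nat_const -big_split /=; apply/andP; split.
  by apply: leq_sum => s _; case/andP: (count_selected s t).
by apply: leq_sum => s _; case/andP: (count_selected s t) => _ /ltnW.
Qed.

End Throughput.

(** * Convergence of the throughput ratio *)

Section Limit.
Context {R : realType}.
Local Open Scope classical_set_scope.

Lemma bounded_nat_stationary (f : nat -> nat) b :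
  (forall s t, s <= t -> f s <= f t) -> (forall t, f t <= b) ->
  exists T, forall t, T <= t -> f t = f T.
Proof.
move=> Hm Hb; pose P n := `[< exists t, f t = n >].
have exP : exists n, P n by exists (f 0); apply/asboolP; exists 0.
have ubP n : P n -> n <= b by move=> /asboolP[t <-].
case: (ex_maxnP exP ubP) => n /asboolP[T <-] Hmax; exists T => t Tt.
by apply/eqP; rewrite eqn_leq (Hm T t) // andbT; apply: Hmax; apply/asboolP; exists t.
Qed.

(** Here [s], [n], [d], [o] count packets selected, injected, delivered by the protocol and by OPT.
    If [n] is bounded, all become constant; otherwise [o] and [m * d] differ by a bounded amount and
    the limit is [1 / m]. *)
Lemma ratio_limit (m L K t0 : nat) (s n d o : nat -> nat) :
  0 < m ->
  (forall t t', t <= t' -> s t <= s t') -> (forall t t', t <= t' -> n t <= n t') ->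
  (forall t, s t <= s (t - L) + L) -> (forall t, n t <= n (t - L) + L) ->
  (forall t, s (t - L) <= d t <= s t) -> (forall t, n (t - L) <= o t <= n t) ->
  (forall t, n t <= m * s t <= n t + K) -> 0 < n t0 ->
  exists2 l : R, ((d t)%:R / (o t)%:R)%R @[t --> \oo] --> l & (m%:R^-1 <= l)%R.
Proof.
move=> m0 Hs Hn Ls Ln Hd Ho Hmn Hn0.
case: (pselect (exists b, forall t, n t <= b)) => [[b Hb]|Hub].
  have [T1 HT1] := bounded_nat_stationary Hn Hb.
  have Hsb t : s t <= b + K.
    by have /andP[_] := Hmn t; have := Hb t; have := leq_pmull (s t) m0; lia.
  have [T2 HT2] := bounded_nat_stationary Hs Hsb.
  exists ((s T2)%:R / (n T1)%:R)%R.
    apply/cvgrPdist_le => eps eps0; exists (T1 + T2 + L) => // t /= Ht.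
    have Ed : d t = s T2.
      have /andP[H1 H2] := Hd t; apply/eqP; rewrite eqn_leq -{1}(HT2 t) ?H2 /=; last by lia.
      by rewrite -(HT2 (t - L)) //; lia.
    have Eo : o t = n T1.
      have /andP[H1 H2] := Ho t; apply/eqP; rewrite eqn_leq -{1}(HT1 t) ?H2 /=; last by lia.
      by rewrite -(HT1 (t - L)) //; lia.
    by rewrite Ed Eo subrr normr0 ltW.
  have nT : 0 < n T1.
    by rewrite -(HT1 (T1 + t0)) ?leq_addr // (leq_trans Hn0) // Hn // leq_addl.
  rewrite ler_pdivlMr ?ltr0n // mulrC ler_pdivrMr ?ltr0n // -natrM ler_nat mulnC.
  have /andP[] := Hmn (T1 + T2); rewrite (HT1 (T1 + T2)) ?leq_addr // (HT2 (T1 + T2)) ?leq_addl //.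
exists (m%:R^-1)%R => //.
(* [o <= n <= m * s <= m * d + m * L] and [m * d <= m * s <= n + K <= o + L + K]. *)
pose C := m * L + L + K.
have Hc t : (`|(o t)%:R - m%:R * (d t)%:R| <= C%:R :> R)%R.
  have /andP[d1 d2] := Hd t; have /andP[h1 h2] := Ho t; have /andP[n1 n2] := Hmn t.
  have s1 := Ls t; have l1 := Ln t.
  have s2 : m * s t <= m * (d t + L) by rewrite leq_mul2l (leq_trans s1) ?orbT // leq_add2r.
  have d3 : m * d t <= m * s t by rewrite leq_mul2l d2 orbT.
  have H1 : ((o t)%:R <= m%:R * (d t)%:R + C%:R :> R)%R.
    by rewrite -natrM -natrD ler_nat /C; rewrite mulnDr in s2; lia.
  have H2 : (m%:R * (d t)%:R <= (o t)%:R + C%:R :> R)%R.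
    by rewrite -natrM -natrD ler_nat /C; lia.
  by rewrite ler_norml; apply/andP; split; lra.
apply/cvgrPdist_le => eps eps0.
have [N HN] : exists N : nat, (C%:R / eps <= N%:R :> R)%R.
  by exists (Num.bound (C%:R / eps)%R); apply/ltW/archi_boundP; rewrite divr_ge0 // ltW.
have [T HT] : exists T, N < n T.
  apply: contrapT => H; apply: Hub; exists N => t; rewrite leqNgt; apply/negP => Ht.
  by apply: H; exists t.
exists (T + L) => // t /= Ht.
have oN : N < o t.
  have /andP[h1 _] := Ho t; apply: leq_trans h1; apply: leq_trans HT _; apply: Hn; lia.
have o0 : (0 < (o t)%:R :> R)%R by rewrite ltr0n; lia.
have mr0 : (0 < m%:R :> R)%R by rewrite ltr0n.
have -> : (m%:R^-1 - (d t)%:R / (o t)%:R = ((o t)%:R - m%:R * (d t)%:R) / (m%:R * (o t)%:R) :> R)%R.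
  by field; rewrite !gt_eqF.
rewrite normrM normfV (gtr0_norm (mulr_gt0 mr0 o0)) ler_pdivrMr ?mulr_gt0 //.
apply: le_trans (Hc t) _; rewrite ler_pdivrMr // mulrC in HN; apply: le_trans HN _.
rewrite ler_pM2l // -natrM ler_nat; apply: leq_trans (ltnW oN) _.
exact: leq_pmull.
Qed.

End Limit.

Local Open Scope classical_set_scope.
Local Open Scope ring_scope.

Theorem corollary2 (R : realType) :
  exists2 C : R, 0 < C &
  forall (V : finType) (n : nat) (e : rel V) (S : {set V}) (D : nat)
    (A : V -> V * V -> R) (alpha : nat) (Tmin : V -> {ffun V -> V}) (K : R),
  #|V| = n ->
  symmetric e ->
  irreflexive e ->
  (forall u v, connect e u v) ->
  diameter e = D ->
  (forall u v w, e v w -> 0 <= A u (v, w)) ->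
  degradation_distance e A alpha ->
  (forall s, s \in S -> min_bfs_tree e A s (Tmin s)) ->
  K = \big[Num.max/0]_(s in S) avg_layer_aff e A s (Tmin s) ->
  exists2 P : protocol V, broadcast_protocol e A P &
  forall inj : injection V,
    legal_injection S inj ->
    (exists i, (0 < i)%N /\ inj i <> None) ->
    forall opt : execution V,
    opt_execution e A inj opt ->
    exists2 l : R,
      throughput_ratio e A inj (run e A P inj) opt t @[t --> \oo] --> l &
      (C * Num.max 1 (alpha%:R * K * log2 (n%:R)))^-1 <= l.

Proof.
exists 12%:R => [|V n e S D A alpha Tmin K _ _ e_irr e_conn _ _ _ _ _]; first by rewrite ltr0n.
(* A single node delivers all injected packets at once, so there it must select them all. *)
pose m := if (1 < #|V|)%N then 12%N else 1%N.
have m0 : (0 < m)%N by rewrite /m; case: ifP.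
have speed : exists L0, forall a c W, (forall s, (m * c s <= a s)%N) ->
    deliverable e A a W -> deliverable e A c (W %/ 4 + L0).
  rewrite /m; case: ltnP => [V2|V1]; first exact: deliverable_speedup.
  exists 0%N => a c W _ _; exists (fun _ _ => None) => v s k _.
  apply: (@knows_mono _ _ _ _ _ 0%N) => //=; apply/eqP.
  by apply: (card_le1_eqP V1).
have Vm : (1 < #|V|)%N \/ m = 1%N by rewrite /m; case: ifP; [left|right].
exists (sampling_protocol A e_irr e_conn m); first by move=> inj; apply: valid_sampling.
move=> inj Hinj [[|i0] [// _ Hi0]] opt [Hopt [B HB]]; have [L0 HL0] := speed.
have [lat Hlat] := selected_delivered e_irr e_conn m0 Hinj Hopt HB HL0.
set alg := run _ _ _ _.
have mono (P : pred nat) t t' : (t <= t')%N -> (count P (iota 0 t) <= count P (iota 0 t'))%N.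
  by move=> /subnKC <-; rewrite iotaD count_cat leq_addr.
have [l Hl ml] : exists2 l : R,
    ((num_delivered e A inj alg t)%:R / (num_delivered e A inj opt t)%:R) @[t --> \oo] --> l &
    m%:R^-1 <= l.
  apply: (@ratio_limit R m (lat + B.+1) (m * #|V|) i0.+1
           (num_selected m inj) (num_injected inj)) => //.
  - by move=> t t'; apply: mono.
  - by move=> t t'; apply: mono.
  - by move=> t; apply: count_iota_lag.
  - by move=> t; apply: count_iota_lag.
  - move=> t; rewrite (num_delivered_selected A e_irr e_conn Hinj) // andbT num_deliveredE.
    apply: (leq_trans (mono _ _ (t - lat)%N _)); first by lia.
    apply: count_iota_delay => i Hi; case E: (inj i.+1) => [[s p]|] // Hs.
    by apply: Hlat Hs E _; apply: ltnW.
  - move=> t; rewrite num_delivered_injected andbT num_deliveredE.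
    apply: (leq_trans (mono _ _ (t - B.+1)%N _)); first by lia.
    apply: count_iota_delay => i Hi; case E: (inj i.+1) => [[s p]|] // _.
    apply/forallP => v; apply: has_packet_mono (forallP (HB _ _ _ (ltn0Sn _) E) v).
    by move: Hi; lia.
  - by move=> t; apply: num_selected_bounds.
  - rewrite /num_injected -has_count; apply/hasP; exists i0; first by rewrite mem_iota add0n ltnSn.
    by case: (inj i0.+1) Hi0.
exists l => //; apply: le_trans ml.
have max1 : (1 : R) <= Num.max 1 (alpha%:R * K * log2 n%:R) by rewrite le_max lexx.
rewrite lef_pV2 ?posrE ?ltr0n ?mulr_gt0 ?ltr0n ?(lt_le_trans ltr01) //.
(* [m <= 12], and the maximum is at least 1. *)
apply: (@le_trans _ _ 12%:R); first by rewrite ler_nat /m; case: ifP.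
by rewrite ler_peMr // ler0n.
Qed.
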